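(* Let $m\ge2$ be an integer and $\kappa<0$, and let $\mathcal O(-m)$ carry the toric symplectic structure with moment polytope $$\overline\Delta_{1,m}(\kappa)=\{x\in\mathbb R^2:\ x_1\ge0,\ x_2+\kappa\ge0,\ -x_1+mx_2\ge0\}.$$ Then for every $u\in\mathrm{Int}\,\overline\Delta_{1,m}(\kappa)$ the Lagrangian torus fiber $L_u\subset\mathcal O(-m)$ over $u$ is displaceable by (probes or) extended probes.
   Context: $\mathcal O(-m)$ is the total space of the complex line bundle of Chern class $-m$ over $\mathbb{CP}^1$, with the symplectic toric structure (unique up to equivariant symplectomorphism) whose moment map image is the smooth polygon $\overline\Delta_{1,m}(\kappa)$; $L_u$ is the moment fiber over $u$. A set $X$ is displaceable if some compactly supported Hamiltonian diffeomorphism $\phi$ satisfies $\phi(X)\cap\overline X=\emptyset$. Probes and extended probes in a rational polygon $\Delta$ (facets $F\subset\{\langle\eta_F,x\rangle+\kappa_F=0\}$, $\eta_F$ primitive interior conormal). If $x-y=tv$ with $v$ primitive integral, $d_{\mathrm{aff}}(x,y)=|t|$; $d_{\mathrm{aff}}(x,F)=|\langle\eta_F,x\rangle+\kappa_F|$. A probe $P$ is a directed segment in $\Delta$ from $b_P$ in the interior of a facet $F_P$ to $b_P+\ell(P)v_P$, with $v_P\in\mathbb Z^2$ primitive and $\langle\eta_{F_P},v_P\rangle=1$; $\ell(P)$ is its length. For $u\in\mathrm{Int}\,\Delta$, $L_u$ is displaceable by (probes or) extended probes if one of the following holds (each implies that $L_u$ is displaceable): (a) $u\in P$ for a probe $P$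 and $d_{\mathrm{aff}}(u,F_P)<\frac12\ell(P)$. (b) There are a symmetric probe $Q$ (its endpoint lies in the interior of a facet $F_Q'$ with $\langle\eta_{F_Q'},v_Q\rangle=-1$), with affine reflection $A_Q(x)=x+\langle\eta_{F_Q'}-\eta_{F_Q},x\rangle v_Q+(\kappa_{F_Q'}-\kappa_{F_Q})v_Q$ and linear part $\widehat A_Q$, a probe $P$ ending at $x_{PQ}$ in the interior of $Q$, and a segment $P'\subset\Delta$ from $x_{PQ}'=A_Q(x_{PQ})$ to $x'_{PQ}+\ell(P')\widehat A_Q(v_P)$, such that either $u\in\mathrm{Int}\,P$ and $d_{\mathrm{aff}}(u,F_P)<\frac12(\ell(P)+\ell(P'))$, or $u\in\mathrm{Int}\,P'$ and $\ell(P)+d_{\mathrm{aff}}(x'_{PQ},u)<\frac12(\ell(P)+\ell(P'))$ (symmetric extended probe). (c) There are probes $P,Q$ with $P$ ending at $x_{PQ}\in Q$ and $v_P$ parallel to $F_Q$, points $x_{\mathcal F},x_{\mathcal F}'\in Q$ and $\ell(\mathcal F)\ge0$ such that the convex hull of $x_{\mathcal F},x'_{\mathcal F},x_{\mathcal F}+\ell(\mathcal F)v_P,x'_{\mathcal F}+\ell(\mathcal F)v_P$ lies in $\Delta$, $u\in\mathrm{Int}\,P$, $d_{\mathrm{aff}}(u,F_P)<\frac12(\ell(P)+\ell(\mathcal F))$ and $d_{\mathrm{aff}}(x_{PQ},F_Q)<d_{\mathrm{aff}}(x_{\mathcal F},x'_{\mathcal F})$ (parallel extended probe with flag). *)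

(* Defs.v *)
From mathcomp Require Import all_boot all_order all_algebra.
From mathcomp Require Import all_classical all_reals all_analysis.
From mathcomp Require Import ring lra.

Set Implicit Arguments.
Unset Strict Implicit.
Unset Printing Implicit Defensive.

Import Order.TTheory GRing.Theory Num.Theory.
Import numFieldNormedType.Exports.

Local Open Scope classical_set_scope.
Local Open Scope ring_scope.

Definition primitive (v : int * int) : bool := coprimez v.1 v.2.

Definition realvec (R : realType) (v : int * int) : R * R :=
  (v.1%:~R, v.2%:~R).

Definition pairing (R : realType) (eta : int * int) (x : R * R) : R :=
  eta.1%:~R * x.1 + eta.2%:~R * x.2.

(* Irredundancy of the inequalities is not required: by the definition of
   [facet_interior], a redundant one has no facet interior unless it repeats
   another inequality, so it carries no additional probe. *)
Record rational_polygon (R : realType) := RationalPolygon {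
  nfacets : nat;
  conormal : 'I_nfacets -> int * int;
  offset : 'I_nfacets -> R;
  conormal_primitive : forall i, primitive (conormal i) }.

Definition polygon (R : realType) (D : rational_polygon R) : set (R * R) :=
  [set x | forall i : 'I_(nfacets D),
     0 <= pairing (conormal i) x + offset i].

Definition facet_line (R : realType) (D : rational_polygon R)
    (i : 'I_(nfacets D)) : set (R * R) :=
  [set x | pairing (conormal i) x + offset i = 0].

Definition facet (R : realType) (D : rational_polygon R)
    (i : 'I_(nfacets D)) : set (R * R) :=
  polygon D `&` facet_line i.

(* The interior of a facet is taken relative to the line supporting it. *)
Definition facet_interior (R : realType) (D : rational_polygon R)
    (i : 'I_(nfacets D)) : set (R * R) :=
  [set x | facet i x /\ \forall y \near x, facet_line i y -> facet i y].

(* Junk value 0 when x - y does not have a rational direction; otherwise the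
   value is unique, see [daffE]. *)
Definition daff (R : realType) (x y : R * R) : R :=
  xget 0 [set d | exists v : int * int, exists t : R,
                  [/\ primitive v, x - y = t *: realvec R v & d = `|t| ] ].

Definition daff_facet (R : realType) (D : rational_polygon R) (x : R * R)
    (i : 'I_(nfacets D)) : R :=
  `| pairing (conormal i) x + offset i |.

Definition seg (R : realType) (b v : R * R) (l : R) : set (R * R) :=
  [set x | exists2 t : R, 0 <= t <= l & x = b + t *: v].

Definition seg_interior (R : realType) (b v : R * R) (l : R) : set (R * R) :=
  [set x | exists2 t : R, 0 < t < l & x = b + t *: v].

Record probe (R : realType) (D : rational_polygon R) := Probe {
  pfacet : 'I_(nfacets D);
  pbase : R * R;
  pdir : int * int;
  plen : R;
  plen_gt0 : 0 < plen;
  pdir_primitive : primitive pdir;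
  pdir_transverse : pairing (conormal pfacet) (realvec R pdir) = 1;
  pbase_facet : facet_interior pfacet pbase;
  probe_sub : seg pbase (realvec R pdir) plen `<=` polygon D }.

Section Probe.
Variables (R : realType) (D : rational_polygon R).
Implicit Types P Q : probe D.

Definition pvec P : R * R := realvec R (pdir P).
Definition pend P : R * R := pbase P + plen P *: pvec P.
Definition points P : set (R * R) := seg (pbase P) (pvec P) (plen P).
Definition interior_points P : set (R * R) :=
  seg_interior (pbase P) (pvec P) (plen P).

(* [i] is the facet at which the symmetric probe [Q] ends. *)
Definition symmetric_probe Q (i : 'I_(nfacets D)) : Prop :=
  facet_interior i (pend Q) /\ pairing (conormal i) (pvec Q) = -1.

Definition reflection_linear Q (i : 'I_(nfacets D)) (x : R * R) : R * R :=
  x + (pairing (conormal i) x - pairing (conormal (pfacet Q)) x) *: pvec Q.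

Definition reflection Q (i : 'I_(nfacets D)) (x : R * R) : R * R :=
  reflection_linear Q i x + (offset i - offset (pfacet Q)) *: pvec Q.

Definition displaceable_by_probe (u : R * R) : Prop :=
  exists P, points P u /\ daff_facet u (pfacet P) < plen P / 2.

(* [l'] and [v'] are the length and the direction of the segment P' obtained
   by deflecting [P] along [Q], and [x'] is its starting point. *)
Definition displaceable_by_symmetric_extended_probe (u : R * R) : Prop :=
  exists (P Q : probe D) (i : 'I_(nfacets D)) (l' : R),
    let x' := reflection Q i (pend P) in
    let v' := reflection_linear Q i (pvec P) in
    [/\ symmetric_probe Q i,
        interior_points Q (pend P),
        0 < l',
        seg x' v' l' `<=` polygon D
      & interior_points P u /\
          daff_facet u (pfacet P) < (plen P + l') / 2
        \/ seg_interior x' v' l' u /\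
          plen P + daff x' u < (plen P + l') / 2 ].

Definition convex_hull (A : set (R * R)) : set (R * R) :=
  smallest (@convex_set R (R * R)%type) A.

Definition displaceable_by_parallel_extended_probe (u : R * R) : Prop :=
  exists (P Q : probe D) (x x' : R * R) (l : R),
    [/\ points Q (pend P) /\ pairing (conormal (pfacet Q)) (pvec P) = 0,
        points Q x /\ points Q x',
        0 <= l /\
          convex_hull [set x; x'; x + l *: pvec P; x' + l *: pvec P]
            `<=` polygon D,
        interior_points P u /\ daff_facet u (pfacet P) < (plen P + l) / 2
      & daff_facet (pend P) (pfacet Q) < daff x x' ].

(* Displaceability of the fiber over [u] by (probes or) extended probes. *)
Definition displaceable_by_extended_probes (u : R * R) : Prop :=
  [\/ displaceable_by_probe u,
      displaceable_by_symmetric_extended_probe u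
    | displaceable_by_parallel_extended_probe u].

End Probe.

Definition Delta1_conormal (m : nat) (i : 'I_3) : int * int :=
  tnth [tuple (1, 0); (0, 1); (-1, m%:Z)] i.

Definition Delta1_offset (R : realType) (kappa : R) (i : 'I_3) : R :=
  tnth [tuple 0; kappa; 0] i.

Fact Delta1_conormal_primitive (m : nat) (i : 'I_3) :
  primitive (Delta1_conormal m i).
Proof.
by case: i => [[|[|[|//]]]] ?; rewrite /primitive /coprimez // gcdNz gcd1z.
Qed.

Definition Delta1 (R : realType) (m : nat) (kappa : R) : rational_polygon R :=
  RationalPolygon (Delta1_offset kappa) (Delta1_conormal_primitive m).

Fact polygon_Delta1 (R : realType) (m : nat) (kappa : R) :
  polygon (Delta1 m kappa) =
  [set x : R * R | [/\ 0 <= x.1, 0 <= x.2 + kappa & 0 <= - x.1 + m%:R * x.2]].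
Proof.
apply/seteqP; split=> x /=.
  move=> h; move: (h (@Ordinal 3 0 isT)) (h (@Ordinal 3 1 isT))
    (h (@Ordinal 3 2 isT)).
  rewrite /pairing /= /Delta1_conormal /Delta1_offset /tnth /= ?mulrNz.
  by rewrite -?pmulrn => h0 h1 h2; split; lra.
case=> h0 h1 h2 [[|[|[|//]]]] ?;
  rewrite /pairing /= /Delta1_conormal /Delta1_offset /tnth /= ?mulrNz -?pmulrn;
  lra.
Qed.

Fact primitive_scale (R : realType) (v w : int * int) (s t : R) :
  primitive v -> s *: realvec R v = t *: realvec R w ->
  exists n : int, s = t * n%:~R.
Proof.
case: v w => [a b] [c d] /= /coprimezP[[p q] /= e] [e1 e2].
have {}e1 : s * a%:~R = t * c%:~R :> R by exact: e1.
have {}e2 : s * b%:~R = t * d%:~R :> R by exact: e2.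
exists (p * c + q * d); rewrite rmorphD !rmorphM /= mulrDr.
have E : p%:~R * a%:~R + q%:~R * b%:~R = 1 :> R.
  by rewrite -!intrM -intrD; move: e => /= ->.
have -> : s = p%:~R * (s * a%:~R) + q%:~R * (s * b%:~R).
  by rewrite -[LHS]mulr1 -[X in _ * X = _]E; ring.
by rewrite e1 e2; ring.
Qed.

Fact daffE (R : realType) (x y : R * R) (v : int * int) (t : R) :
  primitive v -> x - y = t *: realvec R v -> daff x y = `|t|.
Proof.
move=> pv e; rewrite /daff; case: xgetP => [d _ [w [s [pw e' ->]]]|]; last first.
  by move=> /(_ `|t|) h; exfalso; apply: h; exists v, t.
have le_abs (w1 w2 : int * int) (a b : R) : primitive w1 -> primitive w2 ->
    a *: realvec R w1 = b *: realvec R w2 -> `|b| <= `|a|.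
  move=> p1 p2 h; have [n an] := primitive_scale p1 h.
  have [k bk] := primitive_scale p2 (esym h).
  have [n0|n0] := eqVneq n 0; first by rewrite bk an n0 mulr0 mul0r.
  by rewrite an normrM ler_peMr // -intr_norm ler1z -gtz0_ge1 normr_gt0.
apply/eqP; rewrite eq_le; apply/andP; split.
  by apply: (le_abs v w) => //; rewrite -e -e'.
by apply: (le_abs w v) => //; rewrite -e -e'.
Qed.

(* Main.v *)
Require Import Defs.
From mathcomp Require Import all_boot all_order all_algebra.
From mathcomp Require Import all_classical all_reals all_analysis.
From mathcomp Require Import ring lra.

Import Order.TTheory GRing.Theory Num.Theory.
Import numFieldNormedType.Exports.

Local Open Scope classical_set_scope.
Local Open Scope ring_scope.

(** Write c for - kappa > 0, s for the height of u, and F_0, F_1, F_2 for the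
    left, bottom and right facets, on the lines x_1 = 0, x_2 = c and
    x_1 = m x_2.  The horizontal segment at height s has affine length m s and
    both of its directions are integrally transverse to the facets that it
    joins, so horizontal probes displace every fiber to the left or to the
    right of the midpoint m s / 2.  The midpoints are what extended probes are
    for: if m is odd and s is large, no probe displaces them.

    A parallel extended probe with flag reaches them.  Shorten the probe P
    from F_0 so that it ends on a probe Q based on F_1 at (a, c), with direction
    (m - 1, 1).  The ray of Q never leaves the polygon, and the horizontal gap
    between it and F_2 grows without bound with the height.  Hence arbitrarily
    high on Q there is room for a flag whose base is longer than the distance
    s - c from F_1 to the end of P and whose length is as large as we like, in
    particular m s; the fiber is then displaced wherever it meets P.  It remains
    that P passes beyond the midpoint: with a = (m - 1/2) c, which lies on F_1,
    the length of P is (m - 1) s + c / 2, and this exceeds m s / 2 as m >= 2.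

    [displaceable_left] is this construction; it absorbs the fibers to the left
    of the midpoint as well.  [displaceable_right] uses the horizontal probe
    from F_2 for the remaining ones.  Probes are obtained from [exists_probe],
    which reduces the required inclusion to the far endpoint by convexity, and
    flags are checked on the four corners by [convex_polygon]. *)

Lemma pairing_addZ (R : realType) (eta : int * int) (x y : R * R) (t : R) :
  pairing eta (x + t *: y) = pairing eta x + t * pairing eta y.
Proof.
rewrite /pairing.
have -> : (x + t *: y).1 = x.1 + t * y.1 by [].
have -> : (x + t *: y).2 = x.2 + t * y.2 by [].
ring.
Qed.

Lemma addZ_realvec (R : realType) (x1 x2 t : R) (v : int * int) :
  (x1, x2) + t *: realvec R v = (x1 + t * v.1%:~R, x2 + t * v.2%:~R).
Proof. by []. Qed.

Lemma continuous_pairing (R : realType) (eta : int * int) :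
  continuous (pairing eta : R * R -> R).
Proof.
move=> x; apply: cvgD; apply: cvgM;
  [exact: cvg_cst|exact: cvg_fst|exact: cvg_cst|exact: cvg_snd].
Qed.

Lemma convex_polygon (R : realType) (D : rational_polygon R) :
  @convex_set R (R * R)%type (polygon D).
Proof.
move=> x y k; rewrite !inE => Dx Dy i.
have /andP[k0 k1] : (0 : R) <= k%:num <= 1 by apply/andP.
have -> : pairing (conormal i) (conv k x y) =
    k%:num * pairing (conormal i) x + (1 - k%:num) * pairing (conormal i) y.
  rewrite /pairing.
  have -> : (conv k x y).1 = k%:num * x.1 + (1 - k%:num) * y.1 by [].
  have -> : (conv k x y).2 = k%:num * x.2 + (1 - k%:num) * y.2 by [].
  ring.
by have := Dx i; have := Dy i; nra.
Qed.

Lemma seg_sub_polygon (R : realType) (D : rational_polygon R) (b v : R * R)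
    (l : R) :
  0 < l -> polygon D b -> polygon D (b + l *: v) -> seg b v l `<=` polygon D.
Proof.
move=> l0 Db De x [t /andP[t0 tl] ->] i.
have := Db i; have := De i; rewrite !pairing_addZ.
set p := pairing _ b; set q := pairing _ v; set o := offset i => e1 e0.
rewrite -(pmulr_rge0 _ l0).
have -> : l * (p + t * q + o) = (l - t) * (p + o) + t * (p + l * q + o) by ring.
by rewrite addr_ge0 // mulr_ge0 // subr_ge0.
Qed.

(** Moving from [u] against the conormal, which is nonzero because it is
    primitive, decreases the value of the facet functional; a point where it
    vanishes would thus have points outside the polygon arbitrarily close. *)
Lemma interior_polygon_gt0 (R : realType) (D : rational_polygon R) (u : R * R) :
  (polygon D)° u ->
  forall i : 'I_(nfacets D), 0 < pairing (conormal i) u + offset i.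
Proof.
move=> Du i; pose w : R * R := realvec R (conormal i).
have w_gt0 : 0 < pairing (conormal i) w.
  rewrite lt_def /pairing /w /= -!expr2 addr_ge0 ?sqr_ge0 // andbT.
  rewrite paddr_eq0 ?sqr_ge0 // !sqrf_eq0 !intr_eq0.
  apply/negP => /andP[/eqP e1 /eqP e2].
  by have := conormal_primitive i; rewrite /primitive e1 e2.
have cvgu : u - e *: w @[e --> (0 : R)] --> u.
  have {2}-> : u = u - (0 : R) *: w by rewrite scale0r subr0.
  by apply: cvgB; [exact: cvg_cst|apply: cvgZr_tmp; exact: cvg_id].
have /nbhs_ballP[e /= e0 De] := cvgu _ Du.
have /De /(_ i) : ball (0 : R) e (e / 2).
  by rewrite /ball /= sub0r normrN gtr0_norm; lra.
by rewrite -scaleNr pairing_addZ; nra.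
Qed.

(** The other facet inequalities are finitely many and open, so they persist
    near [x]. *)
Lemma facet_interior_strict (R : realType) (D : rational_polygon R)
    (i : 'I_(nfacets D)) (x : R * R) :
  facet_line i x ->
  (forall j, j != i -> 0 < pairing (conormal j) x + offset j) ->
  facet_interior i x.
Proof.
move=> ix gt0x; split.
  split=> // j; have [->|/gt0x/ltW//] := eqVneq j i.
  by rewrite [X in _ <= X]ix.
have : \forall y \near x, forall j, j != i ->
    0 < pairing (conormal j) y + offset j.
  apply: (@filter_forall _ _ _ _ (nbhs_filter x)) => j.
  have [_|/gt0x jx] := eqVneq j i; first exact: nearW.
  have : pairing (conormal j) y + offset j @[y --> x] -->
      pairing (conormal j) x + offset j.
    by apply: cvgD; [exact: continuous_pairing|exact: cvg_cst].
  by move=> /cvgr_gt /(_ _ jx); apply: filterS => y + _.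
apply: filterS => y gt0y iy; split=> // j.
by have [->|/gt0y/ltW//] := eqVneq j i; rewrite [X in _ <= X]iy.
Qed.

(** The facet interior and inclusion conditions in a probe become finitely many
    inequalities at its two endpoints.  Stating existence with equations, rather
    than exhibiting the record, lets the proofs in the sequel forget the
    certificates that the probe carries. *)
Lemma exists_probe (R : realType) (D : rational_polygon R)
    (i : 'I_(nfacets D)) (b : R * R) (v : int * int) (l : R) :
  0 < l -> primitive v -> pairing (conormal i) (realvec R v) = 1 ->
  pairing (conormal i) b + offset i = 0 ->
  (forall j, j != i -> 0 < pairing (conormal j) b + offset j) ->
  polygon D (b + l *: realvec R v) ->
  exists P : probe D, [/\ pfacet P = i, pbase P = b, pdir P = v & plen P = l].
Proof.
move=> l0 pv iv ib gt0b De; have Fb := facet_interior_strict _ _ _ _ ib gt0b.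
have Db : polygon D b by case: Fb => -[].
by exists (Probe l0 pv iv Fb (seg_sub_polygon _ _ _ _ _ l0 Db De)).
Qed.

Lemma Delta1_facetE (R : realType) (m : nat) (kappa : R) (x : R * R)
    (i : 'I_(nfacets (Delta1 m kappa))) :
  pairing (conormal i) x + offset i =
  tnth [tuple x.1; x.2 + kappa; - x.1 + m%:R * x.2] (i : 'I_3).
Proof.
case: i => [[|[|[|//]]]] ?; rewrite /pairing /= /Delta1_conormal /Delta1_offset
  /tnth /= ?mulrNz -?pmulrn; ring.
Qed.

Definition left_facet : 'I_3 := @Ordinal 3 0 isT.
Definition bottom_facet : 'I_3 := @Ordinal 3 1 isT.
Definition right_facet : 'I_3 := @Ordinal 3 2 isT.

Lemma Delta1_interior (R : realType) (m : nat) (kappa : R) (u : R * R) :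
  (polygon (Delta1 m kappa))° u ->
  [/\ 0 < u.1, 0 < u.2 + kappa & u.1 < m%:R * u.2].
Proof.
move=> /interior_polygon_gt0 Du.
have := Du left_facet; have := Du bottom_facet; have := Du right_facet.
by rewrite !Delta1_facetE /tnth /= => h2 h1 h0; split=> //; lra.
Qed.

Lemma exists_left_probe (R : realType) (m : nat) (kappa : R) (y l : R) :
  - kappa < y -> 0 < l <= m%:R * y ->
  exists P : probe (Delta1 m kappa),
    [/\ pfacet P = left_facet, pbase P = (0, y), pdir P = (1, 0) & plen P = l].
Proof.
move=> ky /andP[l0 ly].
apply: exists_probe => //.
- by rewrite /pairing /=; ring.
- by rewrite Delta1_facetE.
- by case=> [[|[|[|//]]]] ? // _; rewrite Delta1_facetE /tnth /=; nra.
- by rewrite addZ_realvec polygon_Delta1; split=> /=; nra.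
Qed.

Lemma exists_right_probe (R : realType) (m : nat) (kappa : R) (y l : R) :
  - kappa < y -> 0 < l <= m%:R * y ->
  exists P : probe (Delta1 m kappa),
    [/\ pfacet P = right_facet, pbase P = (m%:R * y, y), pdir P = (-1, 0)
      & plen P = l].
Proof.
move=> ky /andP[l0 ly].
apply: exists_probe => //.
- by rewrite /pairing /=; ring.
- by rewrite Delta1_facetE /tnth /=; ring.
- by case=> [[|[|[|//]]]] ? // _; rewrite Delta1_facetE /tnth /=; nra.
- by rewrite addZ_realvec polygon_Delta1; split=> /=; nra.
Qed.

(** For [0 <= k <= m] the direction [(k, 1)] lies between the directions of the
    two unbounded facets, so the length is unrestricted. *)
Lemma exists_bottom_probe (R : realType) (m : nat) (kappa : R)
    (a l : R) (k : nat) :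
  0 < a < m%:R * - kappa -> (k <= m)%N -> 0 < l ->
  exists P : probe (Delta1 m kappa),
    [/\ pfacet P = bottom_facet, pbase P = (a, - kappa), pdir P = (k%:Z, 1)
      & plen P = l].
Proof.
move=> /andP[a0 am]; rewrite -(ler_nat R) => km l0.
have k0 : 0 <= k%:R :> R by exact: ler0n.
apply: exists_probe => //.
- by rewrite /primitive /coprimez /= gcdz1.
- by rewrite /pairing /=; ring.
- by rewrite Delta1_facetE /tnth /=; ring.
- by case=> [[|[|[|//]]]] ? // _; rewrite Delta1_facetE /tnth /=; nra.
- by rewrite addZ_realvec polygon_Delta1; split=> /=; nra.
Qed.

Lemma displaceable_right (R : realType) (m : nat) (kappa : R) (u : R * R) :
  - kappa < u.2 -> m%:R * u.2 / 2 < u.1 < m%:R * u.2 ->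
  displaceable_by_probe (Delta1 m kappa) u.
Proof.
move=> ku /andP[u1_gt u1_lt].
have l_itv : 0 < m%:R * u.2 <= m%:R * u.2 by rewrite lexx andbT; nra.
have [P [eF eb ev el]] := exists_right_probe _ _ _ _ _ ku l_itv.
exists P; rewrite /points /pvec /daff_facet eF eb ev el; split.
  exists (m%:R * u.2 - u.1); first by apply/andP; split; lra.
  by rewrite addZ_realvec [LHS]surjective_pairing /=; congr pair; ring.
by rewrite Delta1_facetE /tnth /= ger0_norm; lra.
Qed.

(** The parallel extended probe with flag.  The bound on [u.1] is the length of
    the horizontal probe from the left facet, cut off where it meets the probe
    based on the bottom facet: as the flag is as long as a full horizontal
    segment, every fiber that the cut-off probe meets is displaced. *)
Lemma displaceable_left (R : realType) (m : nat) (kappa : R) (u : R * R) :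
  (2 <= m)%N -> kappa < 0 -> - kappa < u.2 ->
  0 < u.1 < (m%:R - 1) * u.2 - kappa / 2 ->
  displaceable_by_parallel_extended_probe (Delta1 m kappa) u.
Proof.
move=> m_ge2 kappa_lt0 ku /andP[u1_gt0 u1_lt].
have m0 : 2 <= m%:R :> R by rewrite ler_nat.
have u2_gt0 : 0 < u.2 by lra.
have predm : m.-1%:R = m%:R - 1 :> R by rewrite -subn1 natrB // ltnW.
set lP := (m%:R - 1) * u.2 - kappa / 2 in u1_lt.
have lP_itv : 0 < lP <= m%:R * u.2 by apply/andP; rewrite /lP; split; nra.
have [P [PF Pb Pv Pl]] := exists_left_probe _ _ _ _ _ ku lP_itv.
(* Any [a] close enough to the right end [m * - kappa] of the bottom facet would
   do: the larger it is, the further [P] extends. *)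
set a := (m%:R - 1 / 2) * - kappa.
have a_itv : 0 < a < m%:R * - kappa by apply/andP; rewrite /a; split; nra.
have lQ_gt0 : 0 < (m%:R + 1) * u.2 by nra.
have [Q [QF Qb Qv Ql]] :=
  exists_bottom_probe _ _ _ _ _ _ a_itv (leq_pred m) lQ_gt0.
pose q t : R * R := pbase Q + t *: pvec Q.
have qE t : q t = (a + t * (m%:R - 1), - kappa + t).
  by rewrite /q /pvec Qb Qv addZ_realvec /= -pmulrn predm mulr1.
have Qq t : 0 <= t <= (m%:R + 1) * u.2 -> points Q (q t).
  by move=> t_itv; exists t; rewrite ?Ql.
have PE t : pbase P + t *: pvec P = (t, u.2).
  by rewrite /pvec Pb Pv addZ_realvec /= mulr1 mulr0 add0r addr0.
have endE : pend P = q (u.2 + kappa).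
  by rewrite /pend PE Pl qE; congr pair; rewrite /lP /a; field.
(* At parameter [t >= 0] on [Q] the horizontal distance to the right facet is
   [t - kappa / 2], hence from [t = m%:R * u.2] on there is room for a flag of
   length [m%:R * u.2].  Its base has affine length [u.2], whereas the end of
   [P] is at distance [u.2 + kappa] from the bottom facet. *)
exists P, Q, (q (m%:R * u.2)), (q ((m%:R + 1) * u.2)), (m%:R * u.2); split.
- split; first by rewrite endE; apply: Qq; apply/andP; split; nra.
  by rewrite /pvec QF Pv /pairing /=; ring.
- by split; apply: Qq; apply/andP; split; nra.
- split; first by nra.
  apply: smallest_sub; first exact: convex_polygon.
  rewrite !qE /pvec Pv !addZ_realvec polygon_Delta1 /=.
  by move=> x [[[]|]|] ->; split=> /=; rewrite /a; nra.
- rewrite PF Pl /daff_facet Delta1_facetE /tnth /=; split.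
    exists u.1; first by rewrite Pl u1_gt0.
    by rewrite PE -surjective_pairing.
  by rewrite gtr0_norm //; lra.
- rewrite (@daffE _ _ _ (pdir Q) (- u.2)) ?pdir_primitive //; last first.
    rewrite /q opprD addrACA subrr add0r -scalerBl.
    by congr (_ *: _); ring.
  rewrite endE QF /daff_facet Delta1_facetE qE /tnth /=.
  by rewrite normrN !gtr0_norm; lra.
Qed.

Theorem lemma4p2p3 (R : realType) (m : nat) (kappa : R) (u : R * R) :
  (2 <= m)%N -> kappa < 0 ->
  (polygon (Delta1 m kappa))° u ->
  displaceable_by_extended_probes (Delta1 m kappa) u.
Proof.
move=> m_ge2 kappa_lt0 /Delta1_interior[u1_gt0 u2_gt u1_lt].
have m0 : 2 <= m%:R :> R by rewrite ler_nat.
have ku : - kappa < u.2 by lra.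
have [u1_le|u1_gt] := leP u.1 (m%:R * u.2 / 2).
  by apply: Or33; apply: displaceable_left => //; apply/andP; split; nra.
by apply: Or31; apply: displaceable_right => //; rewrite u1_gt.
Qed.
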